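(* There exist a countable Boolean algebra $B$ and a finitely additive probability measure $p$ on $B$ such that $(B,p)$ is non-trivially common cause complete.
   Context: Let $B$ be a Boolean algebra with meet $\land$, join $\lor$ and complement $x'$, and let $p$ be a finitely additive probability measure on $B$. For $x,y\in B$ with $p(y)>0$, write $p(x\mid y)=\frac{p(x\land y)}{p(y)}$ for the conditional probability. For $a,b\in B$ define $\operatorname{cov}_p(a,b)=p(a\land b)-p(a)\,p(b)$; the pair $a,b$ is called positively correlated if $\operatorname{cov}_p(a,b)>0$. Let $a,b,c$ be distinct (i.e. pairwise different) elements of $B$. The element $c$ is a common cause of $a,b$ if the following four conditions hold (in particular the conditional probabilities involved are defined, i.e. $p(c)>0$ and $p(c')>0$): (1) $p(a\land b\mid c)=p(a\mid c)\,p(b\mid c)$; (2) $p(a\land b\mid c')=p(a\mid c')\,p(b\mid c')$; (3) $p(a\mid c)>p(a\mid c')$; (4) $p(b\mid c)>p(b\mid c')$. $(B,p)$ is common cause complete if each pair of distinct elements $a,b\in B$ with $\operatorname{cov}_p(a,b)>0$ has a common cause $c\in B$. It is trivially common cause complete if there is no pair of distinct elements $a,b\in B$ with $\operatorname{cov}_p(a,b)>0$. It is non-trivially common cause complete if it is common cause complete and not trivially so, i.e. at least one pair of distinct elements with positive covariance exists. *)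

(* Defs.v *)
From HB Require Import structures.
From mathcomp Require Import all_boot all_order all_algebra.
From mathcomp Require Import boolp classical_sets functions cardinality reals.

Set Implicit Arguments.
Unset Strict Implicit.
Unset Printing Implicit Defensive.

Import Order.TTheory GRing.Theory Num.Theory.

Local Open Scope ring_scope.

Section CommonCause.
Context {R : realType} {d : Order.disp_t} {B : ctbDistrLatticeType d}.
Implicit Types (p : B -> R) (a b c x y : B).

Definition fa_probability p : Prop :=
  [/\ forall x, 0 <= p x,
      p \top%O = 1
    & forall x y, (x `&` y = \bot)%O -> p (x `|` y)%O = p x + p y].

(* Division by 0 is 0 in R; the positivity of the conditioning event is
   demanded wherever cond_prob is used. *)
Definition cond_prob p x y : R := p (x `&` y)%O / p y.

Definition cov p a b : R := p (a `&` b)%O - p a * p b.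

Definition common_cause p a b c : Prop :=
  [/\ [/\ a <> b, a <> c & b <> c],
      0 < p c /\ 0 < p (~` c)%O
    & [/\ cond_prob p (a `&` b)%O c = cond_prob p a c * cond_prob p b c,
          cond_prob p (a `&` b)%O (~` c)%O =
            cond_prob p a (~` c)%O * cond_prob p b (~` c)%O,
          cond_prob p a (~` c)%O < cond_prob p a c
        & cond_prob p b (~` c)%O < cond_prob p b c]].

Definition cc_complete p : Prop :=
  forall a b, a <> b -> 0 < cov p a b -> exists c, common_cause p a b c.

Definition trivially_cc_complete p : Prop :=
  ~ exists a b, a <> b /\ 0 < cov p a b.

Definition nontrivially_cc_complete p : Prop :=
  cc_complete p /\ ~ trivially_cc_complete p.

End CommonCause.

(* Main.v *)
Require Import Defs.
From HB Require Import structures.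
From mathcomp Require Import all_boot all_order all_algebra.
From mathcomp Require Import boolp classical_sets functions cardinality reals.
From mathcomp Require Import zify ring lra.

(** The algebra consists of the periodic subsets of [nat], which are countably
  many, and the measure is the asymptotic density; it takes rational values, is
  strictly positive, and every [x] has a subset of any prescribed rational
  density [r] with [0 <= r <= p x]. These properties suffice. Let [a <> b] be
  positively correlated. If [a] and [b] are incomparable, a common cause is any
  [c <= a `&` b] of measure [cov p a b / p (~` (a `|` b))], the only value for
  which [a] and [b] become independent given the complement of [c]. If
  [a < b], any [c] with [a < c < b] is a common cause. *)

Set Implicit Arguments.
Unset Strict Implicit.
Unset Printing Implicit Defensive.

Import Order.Theory GRing.Theory Num.Theory.

Local Open Scope ring_scope.

(** * Common causes under a finitely additive probability *)

Section FinitelyAdditive.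
Context {R : realType} {d : Order.disp_t} {B : ctbDistrLatticeType d}.
Variable p : B -> R.
Hypothesis p_prob : fa_probability p.
Implicit Types a b c x y : B.

Lemma fa_ge0 x : 0 <= p x.
Proof. by case: p_prob. Qed.

Lemma fa_top : p \top%O = 1.
Proof. by case: p_prob. Qed.

Lemma fa_join x y : (x `&` y = \bot)%O -> p (x `|` y)%O = p x + p y.
Proof. by case: p_prob => _ _; apply. Qed.

Lemma fa_meetC x y : p (x `&` ~` y)%O = p x - p (x `&` y)%O.
Proof.
rewrite -diffE; have /fa_join : ((x `&` y) `&` (x `\` y) = \bot)%O.
  by rewrite -meetA diffKI meetx0.
by rewrite joinIB => ->; ring.
Qed.

Lemma fa_compl x : p (~` x)%O = 1 - p x.
Proof. by have := fa_meetC \top%O x; rewrite !meet1x fa_top. Qed.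

Lemma fa_le x y : (x <= y)%O -> p x <= p y.
Proof.
move=> /meet_idPr xy; have := fa_ge0 (y `&` ~` x)%O.
by rewrite fa_meetC xy subr_ge0.
Qed.

(* The quantity is [p (~` (a `|` b))], and it equals
   [p (~` a) * p (~` b) + cov p a b]. *)
Lemma cov_gt0_neither a b : 0 < cov p a b -> 0 < 1 + p (a `&` b)%O - p a - p b.
Proof.
have : 0 <= (1 - p a) * (1 - p b) by rewrite -!fa_compl mulr_ge0 ?fa_ge0.
rewrite /cov; lra.
Qed.

Lemma covC a b : cov p a b = cov p b a.
Proof. by rewrite /cov meetC mulrC. Qed.

Lemma common_cause_sym a b c : common_cause p a b c -> common_cause p b a c.
Proof.
move=> [[ab ac bc] pc [h1 h2 h3 h4]]; split=> //; first by split=> // /esym.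
by split=> //; rewrite [(b `&` a)%O]meetC mulrC.
Qed.

Lemma common_cause_below a b c :
  a <> b -> a <> c -> b <> c -> (c <= a `&` b)%O -> 0 < cov p a b ->
  p c * (1 + p (a `&` b)%O - p a - p b) = cov p a b ->
  common_cause p a b c.
Proof.
move=> ab ac bc c_ab cov0 pcE.
have /andP[c_a c_b] : (c <= a)%O && (c <= b)%O by rewrite -lexI.
have neither_gt0 := cov_gt0_neither cov0.
have pc0 : 0 < p c by rewrite -(pmulr_lgt0 _ neither_gt0) pcE.
have pab_a : p (a `&` b)%O <= p a by apply/fa_le/leIl.
have pab_b : p (a `&` b)%O <= p b by apply/fa_le/leIr.
have pc_ab := fa_le c_ab.
have pc'0 : 0 < 1 - p c by lra.
split=> //; first by rewrite fa_compl.
rewrite /cond_prob !fa_meetC fa_compl.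
rewrite (meet_idPr c_ab) (meet_idPr c_a) (meet_idPr c_b) divff ?gt_eqF //.
rewrite !ltr_pdivrMr // !mul1r; split=> //; [|lra..].
apply: (mulIf (lt0r_neq0 pc'0)); rewrite divfK ?gt_eqF //.
apply: (mulIf (lt0r_neq0 pc'0)).
have -> : (p a - p c) / (1 - p c) * ((p b - p c) / (1 - p c)) * (1 - p c) *
          (1 - p c) = (p a - p c) * (p b - p c) by field; rewrite gt_eqF.
move: pcE; rewrite /cov => pcE; lra.
Qed.

Lemma common_cause_between a b c :
  (forall x, p x = 0 -> x = \bot%O) ->
  0 < cov p a b -> (a < c)%O -> (c < b)%O -> common_cause p a b c.
Proof.
move=> p_inj0 cov0 ac cb.
have [lac lcb] := (ltW ac, ltW cb); have lab := le_trans lac lcb.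
have pa0 : 0 < p a.
  rewrite lt0r fa_ge0 andbT; apply: contraTneq cov0 => pa0.
  by rewrite /cov (meet_idPl lab) pa0 mul0r subrr ltxx.
have pb1 : p b < 1.
  by move: cov0; rewrite /cov (meet_idPl lab) -[X in X - _]mulr1 -mulrBr
    pmulr_rgt0 // subr_gt0.
have pc0 : 0 < p c by apply: lt_le_trans (fa_le lac).
have pcb := fa_le lcb.
have pc'0 : 0 < 1 - p c by lra.
split; [|by rewrite fa_compl|].
  split; apply/eqP; rewrite ?(lt_eqF ac) ?(gt_eqF cb) //.
  by rewrite (lt_eqF (lt_trans ac cb)).
rewrite /cond_prob !fa_meetC fa_compl (meet_idPl lab) (meet_idPl lac).
rewrite (meet_idPr lcb) subrr !mul0r divff ?gt_eqF // mulr1.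
split=> //; first exact: divr_gt0.
rewrite ltr_pdivrMr //; lra.
Qed.

Lemma rational_divisible_nontrivially_cc_complete :
  (forall x, p x = 0 -> x = \bot%O) ->
  (forall x, exists q : rat, p x = ratr q) ->
  (forall x (q : rat), 0 <= q -> ratr q <= p x ->
     exists2 y, (y <= x)%O & p y = ratr q) ->
  nontrivially_cc_complete p.
Proof.
move=> p_inj0 p_rat p_div; split; last first.
  apply.
  (* Nested elements of measures 1/4 and 1/2 have covariance 1/4 - 1/8. *)
  have [||b _ pb] := p_div \top%O 2^-1 => //.
    by rewrite fa_top fmorphV rmorph_nat; lra.
  have [||a ab pa] := p_div b 4^-1 => //.
    by rewrite pb !fmorphV !rmorph_nat; lra.
  move: pa pb; rewrite !fmorphV !rmorph_nat => pa pb.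
  exists a, b; split; last by rewrite /cov (meet_idPl ab) pa pb; lra.
  by move=> /(congr1 p); rewrite pa pb; lra.
move=> a b ab cov0.
(* Add to [x] a part of [y] minus [x] having half its measure, which is nonzero by strict
   positivity. *)
have interpolate x y : (x < y)%O -> exists c, (x < c)%O /\ (c < y)%O.
  move=> lt_xy; have [q qE] := p_rat (y `&` ~` x)%O.
  have q0 : 0 < ratr q :> R.
    rewrite -qE lt0r fa_ge0 andbT; apply/eqP => /p_inj0/eqP.
    by rewrite -diffE diff_eq0 (lt_geF lt_xy).
  have [||z zle pz] := p_div (y `&` ~` x)%O (q / 2).
  - by apply: divr_ge0 => //; rewrite -(ler0q R) ltW.
  - by rewrite qE fmorph_div rmorph_nat; lra.
  have pz0 : 0 < p z by rewrite pz fmorph_div rmorph_nat; lra.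
  have zy : p z < p (y `&` ~` x)%O by rewrite qE pz fmorph_div rmorph_nat; lra.
  have zx : (x `&` z = \bot)%O.
    by apply/eqP; rewrite meetC disj_leC (le_trans zle) // leIr.
  have px := fa_join zx; have xy := ltW lt_xy.
  exists (x `|` z)%O; split.
    rewrite lt_neqAle leUl andbT; apply: contraTneq pz0 => /(congr1 p).
    by rewrite px; lra.
  rewrite lt_neqAle leUx xy (le_trans zle) ?leIl // !andbT.
  apply: contraTneq zy => /(congr1 p).
  by rewrite px fa_meetC (meet_idPr xy); lra.
case: (comparableP a b) => [lt_ab|lt_ba|nab|//].
- have [c [ac cb]] := interpolate _ _ lt_ab.
  by exists c; apply: common_cause_between.
- have [c [bc ca]] := interpolate _ _ lt_ba.
  by exists c; apply/common_cause_sym/common_cause_between; rewrite 1?covC.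
have [qa qaE] := p_rat a; have [qb qbE] := p_rat b.
have [qab qabE] := p_rat (a `&` b)%O.
have neither_gt0 := cov_gt0_neither cov0.
pose q := (qab - qa * qb) / (1 + qab - qa - qb).
have qE : ratr q = cov p a b / (1 + p (a `&` b)%O - p a - p b).
  by rewrite fmorph_div !rmorphB rmorphD rmorphM rmorph1 /cov qaE qbE qabE.
have [||c c_ab pcE] := p_div (a `&` b)%O q.
- by rewrite -(ler0q R) qE divr_ge0 // ltW.
(* With the denominator cleared, the gap between the two sides is the product shown nonnegative
   next. *)
- rewrite qE ler_pdivrMr //.
  have : 0 <= (p a - p (a `&` b)%O) * (p b - p (a `&` b)%O).
    by rewrite mulr_ge0 // subr_ge0 fa_le ?leIl ?leIr.
  rewrite /cov; lra.
have /andP[c_a c_b] : (c <= a)%O && (c <= b)%O by rewrite -lexI.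
exists c; apply: common_cause_below => //.
- by move=> ac; move: nab; rewrite ac /Order.comparable c_b.
- by move=> bc; move: nab; rewrite bc /Order.comparable c_a orbT.
- by rewrite pcE qE divfK // gt_eqF.
Qed.

End FinitelyAdditive.

(** * Periodic predicates on the naturals and counting *)

Definition periodic n (f : nat -> bool) :=
  (0 < n)%N /\ forall k, f (k + n)%N = f k.

Definition count_below (f : nat -> bool) n := (\sum_(i < n) f i)%N.

Lemma count_belowS f n : count_below f n.+1 = (count_below f n + f n)%N.
Proof. exact: big_ord_recr. Qed.

Lemma periodic_mul m n f : (0 < m)%N -> periodic n f -> periodic (m * n)%N f.
Proof.
move=> m0 [n0 fn]; split; first by rewrite muln_gt0 m0.
move=> k; elim: m {m0} => [|m IHm]; first by rewrite mul0n addn0.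
by rewrite mulSn addnCA addnC fn.
Qed.

Lemma periodic_mod n f : periodic n f -> forall k, f (k %% n)%N = f k.
Proof.
move=> fn k; have n0 := fn.1; rewrite [in RHS](divn_eq k n) addnC.
case: (posnP (k %/ n)) => [->|q0]; first by rewrite addn0.
by rewrite (periodic_mul q0 fn).2.
Qed.

Lemma count_below_mul m n f :
  periodic n f -> count_below f (m * n) = (m * count_below f n)%N.
Proof.
move=> fn; elim: m => [|m IHm]; first by rewrite !mul0n /count_below big_ord0.
rewrite !mulSn -IHm addnC /count_below big_split_ord /= addnC; congr addn.
case: (posnP m) => [->|m0]; first by apply: eq_bigr => i _; rewrite mul0n.
by apply: eq_bigr => i _; rewrite addnC (periodic_mul m0 fn).2.
Qed.

(** The predicate on the left keeps just the first [c] elements of [f]; this is how subsets of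
    prescribed density are cut out. *)
Lemma count_below_truncate f c n :
  count_below (fun k => f k && (count_below f k < c)%N) n =
  minn c (count_below f n).
Proof.
elim: n => [|n IHn]; first by rewrite /count_below !big_ord0 minn0.
rewrite !count_belowS IHn.
case: (f n) => /=; last by rewrite !addn0.
by case: ltnP => /=; lia.
Qed.

(** * The countable Boolean algebra of periodic sets *)

Record perset := PerSet {
  perset_mem :> nat -> bool;
  _ : `[< exists n, periodic n perset_mem >]
}.

HB.instance Definition _ := [isSub for perset_mem].
HB.instance Definition _ := [Choice of perset by <:].

(** Periodicity is stored as a boolean equation, so its proof is irrelevant and extensionality of
    the underlying functions suffices. *)
Lemma persetP (x y : perset) : x =1 y -> x = y.
Proof. by move=> xy; apply/val_inj/funext. Qed.

Lemma perset_periodic (x : perset) : exists n, periodic n x.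
Proof. by case: x => f fP; apply/asboolP. Qed.

(** Some period picked by choice, not necessarily the least one. *)
Definition period (x : perset) : nat := sval (cid (perset_periodic x)).

Lemma periodP x : periodic (period x) x.
Proof. exact: svalP (cid (perset_periodic x)). Qed.

Lemma common_period (x y : perset) : exists n, periodic n x /\ periodic n y.
Proof.
have [xP yP] := (periodP x, periodP y).
exists (period x * period y)%N; split; last exact: periodic_mul xP.1 yP.
by rewrite mulnC; apply: periodic_mul yP.1 xP.
Qed.

Lemma perset_subproof (op : bool -> bool -> bool) (x y : perset) :
  `[< exists n, periodic n (fun k => op (x k) (y k)) >].
Proof.
have [n [[n0 xn] [_ yn]]] := common_period x y.
by apply/asboolP; exists n; split=> // k; rewrite xn yn.
Qed.

Lemma perset_const_subproof b : `[< exists n, periodic n (fun=> b) >].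
Proof. by apply/asboolP; exists 1%N. Qed.

Definition perset_map2 op x y := PerSet (perset_subproof op x y).
Definition perset_const b := PerSet (perset_const_subproof b).
Definition perset_meet := perset_map2 andb.
Definition perset_join := perset_map2 orb.
(** A binary operation ignoring its second argument, so that [perset_subproof] covers complements
    too. *)
Definition perset_compl x := perset_map2 (fun b _ => ~~ b) x x.

Fact perset_display : Order.disp_t. Proof. exact: Order.Disp tt tt. Qed.

Lemma perset_meetC : commutative perset_meet.
Proof. by move=> x y; apply: persetP => k /=; rewrite andbC. Qed.
Lemma perset_joinC : commutative perset_join.
Proof. by move=> x y; apply: persetP => k /=; rewrite orbC. Qed.
Lemma perset_meetA : associative perset_meet.
Proof. by move=> x y z; apply: persetP => k /=; rewrite andbA. Qed.
Lemma perset_joinA : associative perset_join.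
Proof. by move=> x y z; apply: persetP => k /=; rewrite orbA. Qed.
Lemma perset_joinKI y x : perset_meet x (perset_join x y) = x.
Proof. by apply: persetP => k /=; case: (x k). Qed.
Lemma perset_meetKU y x : perset_join x (perset_meet x y) = x.
Proof. by apply: persetP => k /=; case: (x k). Qed.
Lemma perset_meetUl : left_distributive perset_meet perset_join.
Proof. by move=> x y z; apply: persetP => k /=; rewrite andb_orl. Qed.
Lemma perset_meetxx : idempotent_op perset_meet.
Proof. by move=> x; apply: persetP => k /=; rewrite andbb. Qed.

HB.instance Definition _ :=
  Order.isMeetJoinDistrLattice.Build perset_display perset
    (fun _ _ => erefl) (fun _ _ => erefl) perset_meetC perset_joinC
    perset_meetA perset_joinA perset_joinKI perset_meetKU perset_meetUl
    perset_meetxx.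

Lemma perset_leE (x y : perset) : (x <= y)%O = (perset_meet x y == x).
Proof. by []. Qed.

Lemma perset_le0x (x : perset) : (perset_const false <= x)%O.
Proof. by rewrite perset_leE; apply/eqP/persetP. Qed.

Lemma perset_lex1 (x : perset) : (x <= perset_const true)%O.
Proof. by rewrite perset_leE; apply/eqP/persetP => k; rewrite /= andbT. Qed.

HB.instance Definition _ :=
  Order.hasBottom.Build perset_display perset perset_le0x.
HB.instance Definition _ :=
  Order.hasTop.Build perset_display perset perset_lex1.

Lemma perset_joinxC (x : perset) : (x `|` perset_compl x = \top)%O.
Proof. by apply: persetP => k; apply: orbN. Qed.

Lemma perset_meetxC (x : perset) : (x `&` perset_compl x = \bot)%O.
Proof. by apply: persetP => k; apply: andbN. Qed.

HB.instance Definition _ :=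
  Order.TBDistrLattice_hasComplement.Build perset_display perset
    perset_joinxC perset_meetxC.

Lemma perset_le_pointwise (x y : perset) : (forall k, x k -> y k) -> (x <= y)%O.
Proof.
move=> xy; rewrite perset_leE; apply/eqP/persetP => k /=.
by have := xy k; case: (x k) => // ->.
Qed.

Lemma countable_perset : countable [set: perset]%classic.
Proof.
apply/countable_injP.
(* A periodic set is determined by a period and its values below that period, a finite code. *)
exists (fun x : perset => pickle (period x, mkseq x (period x))).
move=> x y _ _ /(pcan_inj pickleK)[nE sE]; apply: persetP => k.
rewrite -(periodic_mod (periodP x)) -(periodic_mod (periodP y)) -nE.
have kn : (k %% period x < period x)%N by rewrite ltn_mod (periodP x).1.
by rewrite -(nth_mkseq false x kn) sE -nE nth_mkseq.
Qed.

(** * Asymptotic density of periodic sets *)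

Section Density.
Context {R : realType}.
Implicit Types x y : perset.

Definition density x : R := (count_below x (period x))%:R / (period x)%:R.

(** After cross-multiplication, both sides count the elements of [x] below the product of the two
    periods. Sets can thus be measured over a common period. *)
Lemma densityE n x : periodic n x -> density x = (count_below x n)%:R / n%:R.
Proof.
move=> xn; have xP := periodP x; have [n0 p0] := (xn.1, xP.1).
apply/eqP; rewrite eqr_div ?pnatr_eq0 -?lt0n // -!natrM mulnC.
by rewrite -count_below_mul // [X in _ == X%:R]mulnC -count_below_mul // mulnC.
Qed.

Lemma density_fa_probability : fa_probability density.
Proof.
split=> [x||x y xy0]; first by rewrite divr_ge0.
  have /densityE -> : periodic 1 (\top%O : perset) by [].
  by rewrite /count_below big_ord1 divr1.
have [n [xn yn]] := common_period x y.
have xyn : periodic n (x `|` y)%O.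
  by split=> [|k]; [exact: xn.1|rewrite /= xn.2 yn.2].
rewrite (densityE xn) (densityE yn) (densityE xyn) -mulrDl -natrD.
congr (_%:R / _); rewrite /count_below -big_split; apply: eq_bigr => i _ /=.
by have /= := congr1 (fun z : perset => z i) xy0; case: (x i); case: (y i).
Qed.

Lemma density_eq0 x : density x = 0 -> x = \bot%O.
Proof.
have [p0 xP] := periodP x.
move=> /eqP; rewrite mulf_eq0 invr_eq0 !pnatr_eq0 (gtn_eqF p0) orbF.
rewrite sum_nat_eq0 => /forallP x0; apply: persetP => k.
rewrite -(periodic_mod (periodP x)).
have kn : (k %% period x < period x)%N by rewrite ltn_mod.
by have := x0 (Ordinal kn); rewrite /= eqb0 => /negbTE.
Qed.

Lemma density_rational x : exists q : rat, density x = ratr q.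
Proof.
exists ((count_below x (period x))%:R / (period x)%:R).
by rewrite fmorph_div !rmorph_nat.
Qed.

(** Write [q] as [s / t] and let [x] have [c] elements in a period [n]. Over the longer period
    [t * n] it has [t * c] of them, at least [s * n] by the bound on [q]; keeping the first [s * n]
    in each such block gives density [s / t]. *)
Lemma density_divisible x (q : rat) : 0 <= q -> ratr q <= density x ->
  exists2 y, (y <= x)%O & density y = ratr q.
Proof.
move=> q0; pose s := `|numq q|%N; pose t := `|denq q|%N.
have t0 : (0 < t)%N by rewrite absz_gt0 denq_neq0.
have -> : ratr q = s%:R / t%:R :> R.
  by rewrite /ratr !natr_absz !ger0_norm ?numq_ge0 // denq_ge0.
set n := period x; set c := count_below x n => qx.
have n0 : (0 < n)%N := (periodP x).1.
have snct : (s * n <= c * t)%N.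
  move: qx; rewrite /density -/n -/c ler_pdivrMr ?ltr0n // mulrAC.
  by rewrite ler_pdivlMr ?ltr0n // -!natrM ler_nat.
have xN : periodic (t * n) x := periodic_mul t0 (periodP x).
(* Reducing [k] modulo [t * n] restarts the selection in every block, which makes it periodic; on
   the first block it is plain truncation. *)
pose f k := x k && (count_below x (k %% (t * n)) < s * n)%N.
have fN : periodic (t * n) f.
  by split=> [|k]; [exact: xN.1|rewrite /f xN.2 modnDr].
have fP : `[< exists m, periodic m f >] by apply/asboolP; exists (t * n)%N.
exists (PerSet fP); first by apply: perset_le_pointwise => k /andP[].
rewrite (densityE (n := t * n)) //=.
have -> : count_below f (t * n) = (s * n)%N.
  transitivity
    (count_below (fun k => x k && (count_below x k < s * n)%N) (t * n)).
    by apply: eq_bigr => i _; rewrite /f modn_small.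
  rewrite count_below_truncate (count_below_mul _ (periodP x)) (mulnC t).
  exact/minn_idPl.
by rewrite !natrM -mulf_div divff ?mulr1 // pnatr_eq0 -lt0n.
Qed.

End Density.

Theorem proposition3p5 (R : realType) :
  exists (d : Order.disp_t) (B : ctbDistrLatticeType d) (p : B -> R),
    [/\ countable [set: B]%classic,
        fa_probability p
      & nontrivially_cc_complete p].
Proof.
exists perset_display, perset, density; split.
- exact: countable_perset.
- exact: density_fa_probability.
apply: rational_divisible_nontrivially_cc_complete.
- exact: density_fa_probability.
- exact: density_eq0.
- exact: density_rational.
- exact: density_divisible.
Qed.
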